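(* Let $S$ be a symmetric operator on a Hilbert space $H$ with finite and equal defect indices $\eta := \dim\ker(S^*-\mathrm{i}) = \dim\ker(S^*+\mathrm{i}) < \infty$, and let $(\Gamma_0,\Gamma_1,\mathbb{C}^\eta)$ be a boundary triple for $S^*$. For complex $\eta\times\eta$ matrices $B, C$ let $T_{B,C}$ be the operator $$\mathcal{D}(T_{B,C}) = \{ f\in\mathcal{D}(S^* ) : B\Gamma_0 f = C\Gamma_1 f\},\qquad T_{B,C}f = S^*f .$$ Then $T_{B,C}$ is maximally dissipative if and only if $\operatorname{rk}(B|-C)=\eta$ and $$\operatorname{Im}(BC^* )\ge 0 .$$ If $B$ is invertible, then the condition $\operatorname{Im}(BC^* )\ge 0$ is equivalent to $\operatorname{Im}(C^*B^{*-1})\ge 0$.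
   Context: Hilbert spaces are complex; inner products are linear in the second and antilinear in the first argument. Symmetric operators are densely defined. $\mathcal{D}$ denotes the domain of an operator. Boundary triple: $(\Gamma_0,\Gamma_1,\mathbb{C}^\eta)$ is a boundary triple for $S^*$ if $\Gamma_0,\Gamma_1:\mathcal{D}(S^* )\to\mathbb{C}^\eta$ are linear, $(\Gamma_0,\Gamma_1):\mathcal{D}(S^* )\to\mathbb{C}^\eta\oplus\mathbb{C}^\eta$ is surjective, Green's identity $\langle f,S^*g\rangle-\langle S^*f,g\rangle=\langle\Gamma_0f,\Gamma_1g\rangle-\langle\Gamma_1f,\Gamma_0g\rangle$ holds for all $f,g\in\mathcal{D}(S^* )$, and $\mathcal{D}(S)=\ker\Gamma_0\cap\ker\Gamma_1$ (in particular $S$ is closed). A densely defined operator $T$ is dissipative if $\operatorname{Im}\langle x,Tx\rangle\ge0$ for all $x\in\mathcal{D}(T)$, and maximally dissipative if it is dissipative and has no non-trivial dissipative extension. For a square matrix $M$, $\operatorname{Im}M:=\frac{1}{2\mathrm{i}}(M-M^* )$. $(B|-C)$ is the $\eta\times2\eta$ block matrix with blocks $B$ and $-C$. *)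

(* Defs.v *)
From HB Require Import structures.
From mathcomp Require Import all_boot all_order all_algebra.
From mathcomp Require Import complex.
From mathcomp Require Import boolp classical_sets reals topology normedtype.
Set Implicit Arguments.
Unset Strict Implicit.
Unset Printing Implicit Defensive.
Import Order.TTheory GRing.Theory Num.Theory.
Import numFieldNormedType.Exports.
Local Open Scope classical_set_scope.
Local Open Scope ring_scope.
Local Open Scope sesquilinear_scope.

(* [inner] is linear in its second argument, hence antilinear in its first.
   Definiteness and completeness come from the underlying complete normed
   space, whose norm is the one induced by [inner]. *)
HB.mixin Record CompleteNormedModule_isHilbert (R : realType) H
    of CompleteNormedModule R[i] H := {
  inner : H -> H -> R[i];
  innerDr : forall x y z : H, inner x (y + z) = inner x y + inner x z;
  innerZr : forall (a : R[i]) (x y : H), inner x (a *: y) = a * inner x y;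
  innerC : forall x y : H, inner x y = (inner y x)^*;
  inner_norm : forall x : H, inner x x = `|x| ^+ 2 }.

#[short(type="hilbertType")]
HB.structure Definition Hilbert (R : realType) :=
  {H of CompleteNormedModule_isHilbert R H & CompleteNormedModule R[i] H}.

Section Operators.
Context {R : realType} {H : hilbertType R}.

Definition subspace (D : set H) : Prop :=
  D 0 /\ forall (a : R[i]) (f g : H), D f -> D g -> D (a *: f + g).

Definition linear_on (V : lmodType R[i]) (D : set H) (F : H -> V) : Prop :=
  forall (a : R[i]) (f g : H), D f -> D g -> F (a *: f + g) = a *: F f + F g.

Definition has_dim (V : set H) (n : nat) : Prop :=
  exists e : 'I_n -> H,
    (forall a : 'I_n -> R[i], \sum_i a i *: e i = 0 -> forall i, a i = 0) /\
    V = [set x | exists a : 'I_n -> R[i], x = \sum_i a i *: e i].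

(* The values of [op T] outside [dom T] are irrelevant: everything below only
   evaluates [op T] on [dom T]. *)
Record operator := Operator { dom : set H; op :> H -> H }.

Definition linear_operator (T : operator) : Prop :=
  subspace (dom T) /\ linear_on (dom T) (op T).

Definition densely_defined (T : operator) : Prop :=
  linear_operator T /\ dense (dom T).

Definition extends (T' T : operator) : Prop :=
  dom T `<=` dom T' /\ forall f, dom T f -> T' f = T f.

Definition symmetric_operator (S : operator) : Prop :=
  densely_defined S /\
  forall f g, dom S f -> dom S g -> inner f (S g) = inner (S f) g.

Definition adjoint_values (S : operator) (g : H) : set H :=
  [set h | forall f, dom S f -> inner g (S f) = inner h f].

(* When [dom S] is dense, [adjoint_values S g] has at most one element, so
   that [xget] selects the value of the adjoint at [g]. *)
Definition adjoint (S : operator) : operator :=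
  Operator [set g | adjoint_values S g !=set0]
           (fun g => xget 0 (adjoint_values S g)).

Definition ker_shift (T : operator) (z : R[i]) : set H :=
  [set f | dom T f /\ T f - z *: f = 0].

Definition dissipative (T : operator) : Prop :=
  densely_defined T /\ forall f, dom T f -> 0 <= 'Im (inner f (T f)).

Definition maximally_dissipative (T : operator) : Prop :=
  dissipative T /\
  forall T' : operator, dissipative T' -> extends T' T -> dom T' = dom T.

Definition dotC n (u v : 'cV[R[i]]_n) : R[i] := \sum_i (u i 0)^* * v i 0.

Record boundary_triple (S : operator) (n : nat)
    (G0 G1 : H -> 'cV[R[i]]_n) : Prop := BoundaryTriple {
  bt_linear0 : linear_on (dom (adjoint S)) G0;
  bt_linear1 : linear_on (dom (adjoint S)) G1;
  bt_surjective : forall u v : 'cV[R[i]]_n,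
    exists f, [/\ dom (adjoint S) f, G0 f = u & G1 f = v];
  bt_green : forall f g, dom (adjoint S) f -> dom (adjoint S) g ->
    inner f (adjoint S g) - inner (adjoint S f) g
    = dotC (G0 f) (G1 g) - dotC (G1 f) (G0 g);
  bt_dom : dom S = [set f | [/\ dom (adjoint S) f, G0 f = 0 & G1 f = 0]] }.

Definition T_BC (S : operator) n (G0 G1 : H -> 'cV[R[i]]_n)
    (B C : 'M[R[i]]_n) : operator :=
  Operator [set f | dom (adjoint S) f /\ B *m G0 f = C *m G1 f]
           (op (adjoint S)).

End Operators.

Arguments operator {R} H.

Definition Im_mx (R : realType) n (M : 'M[R[i]]_n) : 'M[R[i]]_n :=
  (2 * 'i)^-1 *: (M - M ^t*).

(* In [R[i]], [0 <= z] means that z is real and nonnegative. *)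
Definition psdmx (R : realType) n (M : 'M[R[i]]_n) : Prop :=
  forall v : 'cV[R[i]]_n, 0 <= (v ^t* *m M *m v) 0 0.

(* Main.v *)
(* By Green's identity [Im <f, S^* f> = Im <G0 f, G1 f>], so dissipativity of
   [T_BC] only concerns the relation [B u = C v] in boundary values.  With
   [p = v + i u] and [m = v - i u] one has [4 Im (u^* v) = |p|^2 - |m|^2], and
   the relation reads [(C - i B) m = - (C + i B) p].  It is nonnegative iff
   [C - i B] is invertible and [W = - (C - i B)^-1 (C + i B)] is a contraction.
   The condition [Im (B C^* ) >= 0] says, by the same identity, that [W^*] is a
   contraction, which is equivalent; in its presence the rank condition amounts
   to invertibility of [C - i B].
   A dissipative extension [T'] of [T_BC] extends [S], hence is a restriction
   of [S^*].  Subtracting from [f] in [dom T'] an element of [dom T_BC] with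
   the same [p] leaves a vector with [p = 0], so dissipativity forces [m = 0]
   and [f] is in [dom T_BC]. *)
Require Import Defs.
From mathcomp Require Import all_boot all_order all_algebra.
From mathcomp Require Import complex.
From mathcomp Require Import boolp classical_sets reals topology normedtype.
From mathcomp Require Import ring.
Set Implicit Arguments.
Unset Strict Implicit.
Unset Printing Implicit Defensive.
Import Order.TTheory GRing.Theory Num.Theory.
Import numFieldNormedType.Exports.
Local Open Scope ring_scope.
Local Open Scope sesquilinear_scope.

(** * Imaginary parts of complex numbers *)

Section ComplexNumbers.
Context {C : numClosedFieldType}.

Lemma subr_conjC (z : C) : z - z^* = 2 * 'i * 'Im z.
Proof. rewrite ImE; have := sqrCi C => i2; field: i2; exact/eqP. Qed.

Lemma Im_affine_ge0_eq0 (a z : C) :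
  0 <= a -> (forall t, 0 <= a + 'Im (t * z)) -> z = 0.
Proof.
(* This [t] gives [t * z = - 'i * (a + 1)], so the affine expression takes the value -1. *)
have [//|z0 a_ge0 /(_ (- ('i * ((a + 1) / z))))] := eqVneq z 0.
rewrite mulNr -mulrA divfK // raddfN /= ImMil.
rewrite (Creal_ReP _ _) ?rpredD ?ger0_real // opprD addrA subrr sub0r.
by rewrite oppr_ge0 ler10.
Qed.

End ComplexNumbers.

(** * The inner product on boundary values *)

Section DotProduct.
Context {R : realType} {n : nat}.
Implicit Types (u v w : 'cV[R[i]]_n) (A : 'M[R[i]]_n).

Lemma dotCE u v : dotC u v = (u ^t* *m v) 0 0.
Proof. by rewrite mxE; apply: eq_bigr => i _; rewrite !mxE. Qed.

Lemma dotC_conj u v : (dotC u v)^* = dotC v u.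
Proof.
by rewrite rmorph_sum; apply: eq_bigr => i _; rewrite rmorphM /= conjCK mulrC.
Qed.

Lemma dotCDr u v w : dotC u (v + w) = dotC u v + dotC u w.
Proof. by rewrite !dotCE mulmxDr mxE. Qed.

Lemma dotCZr (a : R[i]) u v : dotC u (a *: v) = a * dotC u v.
Proof. by rewrite !dotCE -scalemxAr mxE. Qed.

Lemma dotCDl u v w : dotC (u + v) w = dotC u w + dotC v w.
Proof. by rewrite -dotC_conj dotCDr rmorphD /= !dotC_conj. Qed.

Lemma dotCZl (a : R[i]) u v : dotC (a *: u) v = a^* * dotC u v.
Proof. by rewrite -dotC_conj dotCZr rmorphM /= dotC_conj. Qed.

Lemma dotC_mulmx A u v : dotC u (A *m v) = dotC (A ^t* *m u) v.
Proof.
rewrite !dotCE trmx_mul map_mxM; congr (fun_of_matrix _ 0 0).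
by rewrite trmxCK mulmxA.
Qed.

Lemma dotC_ge0 u : 0 <= dotC u u.
Proof. by apply: sumr_ge0 => i _; rewrite mulrC mul_conjC_ge0. Qed.

Lemma dotC_eq0 u : dotC u u = 0 -> u = 0.
Proof.
move/eqP; rewrite psumr_eq0 => [/allP u0|i _]; last by rewrite mulrC mul_conjC_ge0.
apply/colP => i; rewrite mxE; apply/eqP.
by have := u0 i (mem_index_enum i); rewrite mulrC mul_conjC_eq0.
Qed.

Lemma dotC_cayley u v :
  dotC (v + 'i *: u) (v + 'i *: u) - dotC (v - 'i *: u) (v - 'i *: u)
  = 4 * 'Im (dotC u v).
Proof.
rewrite -scaleNr !(dotCDl, dotCDr, dotCZl, dotCZr) rmorphN /= conjCi ImE dotC_conj.
by field.
Qed.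

Lemma psdmx_Im A :
  psdmx (Im_mx A) <-> forall w, 0 <= 'Im (dotC w (A *m w)).
Proof.
suff E w : (w ^t* *m Im_mx A *m w) 0 0 = 'Im (dotC w (A *m w)).
  by split=> h w; [rewrite -E | rewrite E].
rewrite /Im_mx -scalemxAr -scalemxAl mxE mulmxBr mulmxBl mxE [X in _ + X]mxE.
rewrite -!mulmxA -!dotCE [dotC w (A ^t* *m w)]dotC_mulmx trmxCK -[dotC (A *m w) w]dotC_conj.
by rewrite subr_conjC mulKf // mulf_neq0 ?pnatr_eq0 ?neq0Ci.
Qed.

End DotProduct.

Lemma unitmx_inj (F : fieldType) (n : nat) (A : 'M[F]_n) :
  (forall w : 'cV_n, A *m w = 0 -> w = 0) -> A \in unitmx.
Proof.
move=> h; rewrite -unitmx_tr -row_free_unit; apply: inj_row_free => v vA.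
apply: trmx_inj; rewrite trmx0; apply: h.
by apply: trmx_inj; rewrite trmx_mul trmxK vA trmx0.
Qed.

Definition contractive {R : realType} {n : nat} (W : 'M[R[i]]_n) : Prop :=
  forall p : 'cV[R[i]]_n, dotC (W *m p) (W *m p) <= dotC p p.

(** With [y = W^* p], one has [|p|^2 - |y|^2 = |p - W y|^2 + (|y|^2 - |W y|^2)], and both terms on
    the right are nonnegative. *)
Lemma contractive_adjoint {R : realType} {n : nat} (W : 'M[R[i]]_n) :
  contractive W -> contractive (W ^t*).
Proof.
move=> cW p; rewrite -subr_ge0; set y := W ^t* *m p.
apply: le_trans (dotC_ge0 (p - W *m y)) _.
rewrite -scaleN1r !(dotCDl, dotCDr, dotCZl, dotCZr) rmorphN1 /=.
rewrite [dotC p (W *m y)]dotC_mulmx -/y -[dotC (W *m y) p]dotC_conj.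
rewrite [dotC p (W *m y)]dotC_mulmx -/y dotC_conj.
rewrite -subr_ge0; move: (cW y); rewrite -subr_ge0; congr (0 <= _); ring.
Qed.

(** * The linear relation between boundary values *)

Section BoundaryRelation.
Context {R : realType} {n : nat} (B C : 'M[R[i]]_n).
Implicit Types (u v w p m : 'cV[R[i]]_n).

Let Q := C - 'i *: B.
Let P := C + 'i *: B.

(* In the Cayley coordinates [p = v + i u], [m = v - i u] the relation
   [B u = C v] is the graph of this matrix. *)
Definition cayley_mx : 'M[R[i]]_n := - (invmx Q *m P).

Let W := cayley_mx.

Lemma cayley_surj p m : exists u v, v + 'i *: u = p /\ v - 'i *: u = m.
Proof.
exists ((2 * 'i)^-1 *: (p - m)), (2^-1 *: (p + m)).
have i0 := neq0Ci R[i].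
split; apply/colP => k; rewrite !mxE; field; exact: i0.
Qed.

Lemma cayley_mxE u v : Q \in unitmx ->
  B *m u = C *m v <-> v - 'i *: u = W *m (v + 'i *: u).
Proof.
move=> Qu; have i2 := sqrCi R[i].
(* The cross terms cancel, so the relation says exactly that [Q m + P p = 0]. *)
have E : Q *m (v - 'i *: u) + P *m (v + 'i *: u) = 2 *: (C *m v - B *m u).
  rewrite /Q /P !(mulmxDl, mulmxDr, mulmxN, mulNmx) -!scalemxAl -!scalemxAr.
  by apply/colP => k; rewrite !mxE; ring: i2.
split=> [h|h].
  rewrite /W /cayley_mx mulNmx -mulmxA; apply: (can_inj (mulKmx Qu)).
  rewrite mulmxN mulKVmx //; apply/eqP; rewrite -addr_eq0 E h subrr.
  by rewrite scaler0.
apply/eqP; rewrite eq_sym -subr_eq0; move/eqP: E.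
rewrite h /W /cayley_mx mulNmx mulmxN -mulmxA mulKVmx // addNr eq_sym.
by rewrite scaler_eq0 pnatr_eq0.
Qed.

Definition nonneg_relation : Prop :=
  forall u v, B *m u = C *m v -> 0 <= 'Im (dotC u v).

Lemma nonneg_relationE :
  Q \in unitmx -> nonneg_relation <-> contractive W.
Proof.
move=> Qu; split=> [h p | h u v /cayley_mxE -/(_ Qu) E].
  have [u [v [up um]]] := cayley_surj p (W *m p).
  rewrite -subr_ge0 -um -up dotC_cayley mulr_ge0 //; apply: h.
  by apply/cayley_mxE; rewrite // up um.
rewrite -(pmulr_rge0 _ (ltr0n _ 4)) -dotC_cayley E subr_ge0; exact: h.
Qed.

(** This is [dotC_cayley] at the pair [B^* w], [C^* w]. Conjugation flips the sign of ['i], so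
    [Q^* w] is the [p] coordinate of that pair and [P^* w] its [m] coordinate. *)
Lemma psdmx_cayley : psdmx (Im_mx (B *m C ^t*)) <->
  forall w, dotC (P ^t* *m w) (P ^t* *m w) <= dotC (Q ^t* *m w) (Q ^t* *m w).
Proof.
rewrite psdmx_Im; suff E w : dotC (Q ^t* *m w) (Q ^t* *m w) -
    dotC (P ^t* *m w) (P ^t* *m w) = 4 * 'Im (dotC w (B *m C ^t* *m w)).
  by split=> h w; [rewrite -subr_ge0 E | rewrite -(pmulr_rge0 _ (ltr0n _ 4)) -E];
    rewrite ?mulr_ge0 ?subr_ge0.
rewrite -mulmxA dotC_mulmx -dotC_cayley.
have -> : Q ^t* *m w = C ^t* *m w + 'i *: (B ^t* *m w).
  rewrite scalemxAl -mulmxDl; congr (_ *m _); apply/matrixP => i j.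
  by rewrite !mxE rmorphB rmorphM /= conjCi mulNr opprK.
have -> // : P ^t* *m w = C ^t* *m w - 'i *: (B ^t* *m w).
rewrite scalemxAl -mulmxBl; congr (_ *m _); apply/matrixP => i j.
by rewrite !mxE rmorphD rmorphM /= conjCi mulNr.
Qed.

(** From [P = - Q W] follows [P^* w = - W^* (Q^* w)], and [Q^* w] runs through all vectors. *)
Lemma psdmx_contractive : Q \in unitmx ->
  psdmx (Im_mx (B *m C ^t*)) <-> contractive (W ^t*).
Proof.
move=> Qu; rewrite psdmx_cayley.
have WQ w : P ^t* *m w = - (W ^t* *m (Q ^t* *m w)).
  rewrite mulmxA -map_mxM -trmx_mul /W /cayley_mx mulmxN mulKVmx //.
  by rewrite linearN map_mxN mulNmx opprK.
have NN (x : 'cV[R[i]]_n) : dotC (- x) (- x) = dotC x x.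
  by rewrite -scaleN1r dotCZl dotCZr rmorphN1 mulrA mulrNN !mul1r.
have Qtu : Q ^t* \in unitmx by rewrite map_unitmx unitmx_tr.
split=> h w; last by rewrite WQ NN.
by have := h (invmx (Q ^t*) *m w); rewrite WQ NN mulKVmx.
Qed.

(** If [Q m = 0], the pair [('i m, m)] lies in the relation, and its form has imaginary part
    [- |m|^2]. *)
Lemma nonneg_relation_unit : nonneg_relation -> Q \in unitmx.
Proof.
move=> h; apply: unitmx_inj => m.
rewrite mulmxBl -scalemxAl scalemxAr => /eqP; rewrite subr_eq0 => /eqP /esym.
move=> /h; rewrite dotCZl conjCi mulNr raddfN /= ImMil oppr_ge0.
rewrite (Creal_ReP _ _) ?ger0_real ?dotC_ge0 // => m0.
by apply: dotC_eq0; apply: le_anti; rewrite m0 dotC_ge0.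
Qed.

Lemma rank_unit : Q \in unitmx -> \rank (row_mx B (- C)) = n.
Proof.
move=> Qu; apply/eqP/inj_row_free => v.
rewrite mul_mx_row -[0]row_mx0 => /eq_row_mx[vB /eqP].
rewrite mulmxN oppr_eq0 => /eqP vC.
apply: (can_inj (mulmxK Qu)).
by rewrite mulmxBr -scalemxAr vB vC scaler0 subrr mul0mx.
Qed.

(** Positivity puts the kernel of [Q^*] inside that of [P^*]. A common kernel vector [w] gives
    [w^* B = w^* C = 0], as [B] and [C] are combinations of [P] and [Q]; full row rank then forces
    [w = 0]. *)
Lemma rank_psd_unit : \rank (row_mx B (- C)) = n ->
  psdmx (Im_mx (B *m C ^t*)) -> Q \in unitmx.
Proof.
move=> rk /psdmx_cayley psd.
suff : Q ^t* \in unitmx by rewrite map_unitmx unitmx_tr.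
apply: unitmx_inj => w Qw.
have Pw : P ^t* *m w = 0.
  apply: dotC_eq0; apply: le_anti; rewrite dotC_ge0 andbT.
  by apply: le_trans (psd w) _; rewrite Qw dotCE mulmx0 mxE.
have wQ : w ^t* *m Q = 0.
  by rewrite -[Q]trmxCK -map_mxM -trmx_mul Qw trmx0 map_mx0.
have wP : w ^t* *m P = 0.
  by rewrite -[P]trmxCK -map_mxM -trmx_mul Pw trmx0 map_mx0.
have i0 := neq0Ci R[i].
have wC : w ^t* *m C = 0.
  have -> : C = 2^-1 *: (P + Q).
    by apply/matrixP => i j; rewrite !mxE; field.
  by rewrite -scalemxAr mulmxDr wP wQ addr0 scaler0.
have wB : w ^t* *m B = 0.
  have -> : B = (2 * 'i)^-1 *: (P - Q).
    by apply/matrixP => i j; rewrite !mxE; field.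
  by rewrite -scalemxAr mulmxBr wP wQ subr0 scaler0.
have : w ^t* = 0.
  have rf : row_free (row_mx B (- C)) by apply/eqP.
  apply: (row_free_inj rf).
  by rewrite mul0mx mul_mx_row mulmxN wC wB oppr0 row_mx0.
by move=> w0; rewrite -[w]trmxCK w0 trmx0 map_mx0.
Qed.

Lemma nonneg_relation_psd : nonneg_relation <->
  \rank (row_mx B (- C)) = n /\ psdmx (Im_mx (B *m C ^t*)).
Proof.
split=> [h | [rk psd]].
  have Qu := nonneg_relation_unit h.
  split; first exact: rank_unit.
  by apply/(psdmx_contractive Qu)/contractive_adjoint/(nonneg_relationE Qu).
have Qu := rank_psd_unit rk psd.
apply/(nonneg_relationE Qu); rewrite -[W]trmxCK; apply: contractive_adjoint.
exact/(psdmx_contractive Qu).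
Qed.

(** Meant for the boundary values [u], [v] of an element in the domain of a dissipative
    extension. *)
Lemma nonneg_relation_maximal u v : nonneg_relation ->
  (forall u0 v0, B *m u0 = C *m v0 -> 0 <= 'Im (dotC (u - u0) (v - v0))) ->
  B *m u = C *m v.
Proof.
move=> h max; have Qu := nonneg_relation_unit h.
(* The pair in the relation with the same [p] coordinate as [(u, v)]: only the term [- |m - m0|^2]
   of the form survives in the difference. *)
have [u0 [v0 [p0 m0]]] := cayley_surj (v + 'i *: u) (W *m (v + 'i *: u)).
have /max : B *m u0 = C *m v0 by apply/cayley_mxE; rewrite // p0 m0.
rewrite -(pmulr_rge0 _ (ltr0n _ 4)) -dotC_cayley.
have -> : v - v0 + 'i *: (u - u0) = 0.
  by rewrite scalerBr addrACA -opprD p0 subrr.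
have -> : v - v0 - 'i *: (u - u0) = v - 'i *: u - (v0 - 'i *: u0).
  by rewrite scalerBr !opprD !opprK addrACA.
rewrite {1}dotCE mulmx0 mxE sub0r oppr_ge0 => le0.
apply/cayley_mxE => //; rewrite -m0; apply/eqP; rewrite -subr_eq0; apply/eqP.
by apply: dotC_eq0; apply: le_anti; rewrite le0 dotC_ge0.
Qed.

(** The two quadratic forms are congruent through the bijection [w] to [B^* w]. *)
Lemma psdmx_Im_invmx : B \in unitmx ->
  psdmx (Im_mx (B *m C ^t*)) <-> psdmx (Im_mx (C ^t* *m invmx (B ^t*))).
Proof.
move=> Bu; have Btu : B ^t* \in unitmx by rewrite map_unitmx unitmx_tr.
rewrite !psdmx_Im.
have E w : dotC (B ^t* *m w) (C ^t* *m invmx (B ^t*) *m (B ^t* *m w))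
    = dotC w (B *m C ^t* *m w).
  by rewrite -!mulmxA mulKmx // [RHS]dotC_mulmx.
split=> h w; last by rewrite -E.
by rewrite -[w](mulKVmx Btu) E.
Qed.

End BoundaryRelation.

(** * Adjoints, dissipative extensions and boundary triples *)

Section Operators.
Context {R : realType} {H : hilbertType R}.
Implicit Types (f g h x y z : H) (S T : operator H).

Lemma innerDl x y z : inner (x + y) z = inner x z + inner y z.
Proof. by rewrite innerC innerDr rmorphD /= -!innerC. Qed.

Lemma innerZl (a : R[i]) x y : inner (a *: x) y = a^* * inner x y.
Proof. by rewrite innerC innerZr rmorphM /= -innerC. Qed.

(** Otherwise the open ball of radius [|h|] around [h] contains some [f] in [D], but orthogonality
    gives [|h - f|^2 = |h|^2 + |f|^2]. *)
Lemma dense_orthogonal_eq0 (D : set H) h :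
  dense D -> (forall f, D f -> inner h f = 0) -> h = 0.
Proof.
move=> dD hD; apply/eqP; apply: contraT; rewrite -normr_gt0 => h_gt0.
have [] := dD (ball h `|h|); first by exists h; exact: ballxx.
  exact: ball_open.
move=> f [+ /hD hf]; rewrite -ball_normE /= -ltr_sqr ?nnegrE //.
rewrite -!inner_norm -scaleN1r !(innerDl, innerDr, innerZl, innerZr) hf.
rewrite [inner f h]innerC hf rmorph0 rmorphN1 mulr0 addr0 add0r mulN1r mulNr.
by rewrite mul1r opprK gtrDl !inner_norm le_gtF // exprn_ge0.
Qed.

Lemma adjoint_valuesP S g :
  dom (adjoint S) g -> adjoint_values S g (adjoint S g).
Proof. exact: xgetPex. Qed.

Lemma adjoint_eq S g h : dense (dom S) ->
  adjoint_values S g h -> dom (adjoint S) g /\ adjoint S g = h.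
Proof.
move=> dS gh; have gS : dom (adjoint S) g by exists h.
split=> //; apply/eqP; rewrite -subr_eq0; apply/eqP.
apply: (dense_orthogonal_eq0 dS) => f fS.
by rewrite -scaleN1r innerDl innerZl -gh // -adjoint_valuesP // rmorphN1 mulN1r subrr.
Qed.

Lemma adjoint_linear S : dense (dom S) -> linear_operator (adjoint S).
Proof.
move=> dS.
have lin (a : R[i]) f g : dom (adjoint S) f -> dom (adjoint S) g ->
    adjoint_values S (a *: f + g) (a *: adjoint S f + adjoint S g).
  move=> fS gS x xS; rewrite !(innerDl, innerZl).
  by rewrite (adjoint_valuesP fS) // (adjoint_valuesP gS).
split; last by move=> a f g fS gS; have [] := adjoint_eq dS (lin a f g fS gS).
split; last by move=> a f g fS gS; exists (a *: adjoint S f + adjoint S g); exact: lin.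
by exists 0 => f _; rewrite -(scale0r (0 : H)) !innerZl rmorph0 !mul0r.
Qed.

Lemma symmetric_extends_adjoint S : symmetric_operator S -> extends (adjoint S) S.
Proof.
move=> [[_ dS] sym].
have val f : dom S f -> adjoint_values S f (S f) by move=> fS g gS; exact: sym.
by split=> f /val /(adjoint_eq dS)[].
Qed.

(* Expanding [Im <f + t g, T (f + t g)> >= 0] with [g] in [dom S], the term
   linear in the arbitrary scalar [t] has to vanish. *)
Lemma dissipative_extends_adjoint S T : symmetric_operator S ->
  dissipative T -> extends T S -> extends (adjoint S) T.
Proof.
move=> [[linS dS] sym] [[[[T0 TD] linT] _] diss] [ST TS].
suff val f : dom T f -> adjoint_values S f (T f).
  by split=> f /val /(adjoint_eq dS)[].
move=> fT g gS; apply/eqP; rewrite -subr_eq0; apply/eqP.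
apply: (@Im_affine_ge0_eq0 _ ('Im (inner f (T f)))) => [|t]; first exact: diss.
have gT := ST _ gS.
have := diss _ (TD t g f gT fT).
rewrite linT // TS // !(innerDl, innerDr, innerZl, innerZr).
rewrite [inner g (T f)]innerC.
(* By symmetry [inner g (S g)] is real, so the term quadratic in [t] has no imaginary part. *)
have gg : (inner g (S g))^* = inner g (S g) by rewrite -innerC sym.
congr (0 <= _); rewrite !ImE !(rmorphD, rmorphB, rmorphM) /= !conjCK gg.
by field.
Qed.

Variables (S : operator H) (n : nat) (G0 G1 : H -> 'cV[R[i]]_n).
Hypothesis S_symmetric : symmetric_operator S.
Hypothesis S_triple : boundary_triple S G0 G1.

Lemma boundary_form f : dom (adjoint S) f ->
  'Im (inner f (adjoint S f)) = 'Im (dotC (G0 f) (G1 f)).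
Proof.
move=> fS; have := bt_green S_triple fS fS.
rewrite [inner (adjoint S f) f]innerC -[dotC (G1 f) _]dotC_conj !subr_conjC.
by apply: mulfI; rewrite mulf_neq0 ?pnatr_eq0 ?neq0Ci.
Qed.

Lemma T_BC_extends (B C : 'M[R[i]]_n) : extends (T_BC S G0 G1 B C) S.
Proof.
split=> [f|f fS]; last exact: (symmetric_extends_adjoint S_symmetric).2.
by rewrite (bt_dom S_triple) => -[fS f0 f1]; split; rewrite // f0 f1 !mulmx0.
Qed.

Lemma T_BC_dissipative (B C : 'M[R[i]]_n) :
  dissipative (T_BC S G0 G1 B C) <-> nonneg_relation B C.
Proof.
have [dS [[S0 SD] linS]] : dense (dom S) /\ linear_operator (adjoint S).
  have [[_ dS] _] := S_symmetric; split=> //; exact: adjoint_linear.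
split=> [[_ diss] u v Buv | nn].
  have [f [fS f0 f1]] := bt_surjective S_triple u v.
  by rewrite -f0 -f1 -boundary_form //; apply: diss; split; rewrite // f0 f1.
split; last by move=> f [fS fBC]; rewrite boundary_form //; exact: nn.
have TBCD (a : R[i]) f g : dom (T_BC S G0 G1 B C) f ->
    dom (T_BC S G0 G1 B C) g -> dom (T_BC S G0 G1 B C) (a *: f + g).
  move=> [fS fBC] [gS gBC]; split; first exact: SD.
  rewrite (bt_linear0 S_triple) // (bt_linear1 S_triple) // !mulmxDr.
  by rewrite -!scalemxAr fBC gBC.
have [sub _] := T_BC_extends B C.
split; last first.
  (* Density is inherited from [dom S]. *)
  by move=> U U0 Uo; have [x [Ux /sub xT]] := dS U U0 Uo; exists x.
split; last by move=> a f g [fS _] [gS _]; exact: linS.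
split; last exact: TBCD.
by apply: sub; have [[[[]]]] := S_symmetric.
Qed.

(** Dissipativity alone already yields maximality, because a nonnegative relation is the graph of a
    matrix defined for every [p]. *)
Lemma T_BC_maximally_dissipative (B C : 'M[R[i]]_n) :
  maximally_dissipative (T_BC S G0 G1 B C) <-> nonneg_relation B C.
Proof.
split=> [[/T_BC_dissipative //]|nn]; split; first exact/T_BC_dissipative.
move=> T dT TBC.
have [TS TE] : extends (adjoint S) T.
  apply: dissipative_extends_adjoint => //.
  have [sub1 eq1] := T_BC_extends B C; have [sub2 eq2] := TBC.
  split; first exact: subset_trans sub1 sub2.
  by move=> f fS; rewrite eq2 ?eq1 //; exact: sub1.
apply/seteqP; split; last exact: TBC.1.
move=> f fT; split; first exact: TS.
apply: (nonneg_relation_maximal nn) => u0 v0 Buv.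
have [f0 [f0S f00 f01]] := bt_surjective S_triple u0 v0.
have f0T : dom T f0 by apply: TBC.1; split; rewrite // f00 f01.
have [[[[_ TD] _] _] diss] := dT.
(* The boundary values of [f - f0] are [G0 f - u0] and [G1 f - v0]. *)
have dT' : dom T (- 1 *: f0 + f) by exact: TD.
have := diss _ dT'.
rewrite -TE // boundary_form; last exact: TS.
rewrite (bt_linear0 S_triple) ?(bt_linear1 S_triple); try exact: TS.
by rewrite f00 f01 !scaleN1r ![- _ + _]addrC.
Qed.

End Operators.

Theorem theorem2p6 (R : realType) (H : hilbertType R) (S : operator H)
    (n : nat) (G0 G1 : H -> 'cV[R[i]]_n) (B C : 'M[R[i]]_n)
    (S_symmetric : symmetric_operator S)
    (defect_plus : has_dim (ker_shift (adjoint S) 'i) n)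
    (defect_minus : has_dim (ker_shift (adjoint S) (- 'i)) n)
    (S_triple : boundary_triple S G0 G1) :
  (maximally_dissipative (T_BC S G0 G1 B C) <->
     \rank (row_mx B (- C)) = n /\ psdmx (Im_mx (B *m C ^t*))) /\
  (B \in unitmx ->
     (psdmx (Im_mx (B *m C ^t*)) <->
      psdmx (Im_mx (C ^t* *m invmx (B ^t*))))).
Proof.
split; last exact: psdmx_Im_invmx.
by rewrite T_BC_maximally_dissipative //; exact: nonneg_relation_psd.
Qed.
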